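(* Let $(M,\phi,\xi,\eta,g)$ be a $(2n+1)$-dimensional Sasakian manifold that satisfies $R(\xi,X)\cdot S=0$ for all $X\in\chi(M)$ and admits a $*$-Conformal $\eta$-Ricci soliton. Then $M$ is an Einstein manifold.
   Context: Conventions. $\chi(M)$ is the space of smooth vector fields on $M$; $\nabla$ is the Levi-Civita connection of $g$; $R(X,Y)Z=\nabla_X\nabla_YZ-\nabla_Y\nabla_XZ-\nabla_{[X,Y]}Z$; $S(Y,Z)=\mathrm{trace}\{X\mapsto R(X,Y)Z\}$ is the Ricci tensor. $M$ is Einstein if $S=c\,g$ for some constant $c$. Sasakian manifold. An almost contact metric structure on a connected $(2n+1)$-dimensional manifold $M$ ($n\ge 1$) consists of a $(1,1)$-tensor field $\phi$, a vector field $\xi$, a 1-form $\eta$ and a Riemannian metric $g$ with $\phi^2X=-X+\eta(X)\xi$, $\eta(\xi)=1$, $\eta\circ\phi=0$, $\phi\xi=0$, $g(\phi X,\phi Y)=g(X,Y)-\eta(X)\eta(Y)$, $g(X,\phi Y)=-g(\phi X,Y)$, $g(X,\xi)=\eta(X)$. It is a contact metric structure if $d\eta(X,Y)=g(X,\phi Y)$, and it is normal if $2d\eta(X,Y)\xi+[\phi,\phi](X,Y)=0$, where $[\phi,\phi](X,Y)=\phi^2[X,Y]+[\phi X,\phi Y]-\phi[\phi X,Y]-\phi[X,\phi Y]$ and $d\eta(X,Y)=\frac12\big(X\eta(Y)-Y\eta(X)-\eta([X,Y])\big)$. A Sasakian manifold is a normal contact metric manifold; with these conventions $\nabla_X\xi=-\phi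 X$. Soliton. The $*$-Ricci tensor is $S^*(X,Y)=\frac12\,\mathrm{trace}\{\phi\circ R(X,\phi Y)\}$. $M$ admits a $*$-Conformal $\eta$-Ricci soliton (with data $\lambda,\mu,p$) if $\mathcal{L}_\xi g+2S^*+\left[2\lambda-\left(p+\frac{2}{2n+1}\right)\right]g+2\mu\,\eta\otimes\eta=0$, where $\mathcal{L}_\xi$ is the Lie derivative along $\xi$, $\lambda,\mu$ are real constants and $p$ is a (smooth) scalar field. The condition $R(\xi,X)\cdot S=0$ means $S(R(\xi,X)Y,Z)+S(Y,R(\xi,X)Z)=0$ for all $X,Y,Z\in\chi(M)$. *)

(* Defs.v *)
From HB Require Import structures.
From mathcomp Require Import all_boot all_order all_algebra.
From mathcomp Require Import all_classical all_reals.
From mathcomp Require Import topology normedtype derive.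
From mathcomp Require Import ring.
Set Implicit Arguments.
Unset Strict Implicit.
Unset Printing Implicit Defensive.
Import GRing.Theory Num.Theory numFieldNormedType.Exports.
Local Open Scope classical_set_scope.
Local Open Scope ring_scope.

Section euclidean_smoothness.
Variables (R : realType) (m : nat).
Implicit Types (U : set 'rV[R]_m) (f g : 'rV[R]_m -> R).

(* C^k on [U] through partial derivatives; only used for open [U], where it is
   the usual notion.  Continuity is required at every order because existence of
   the partial derivatives alone does not imply it. *)
Fixpoint class_C (k : nat) U f : Prop :=
  (forall x, U x -> {for x, continuous f}) /\
  match k with
  | 0 => True
  | k'.+1 => forall i : 'I_m,
      (forall x, U x -> derivable f x (delta_mx 0 i)) /\
      class_C k' U (fun x => 'D_(delta_mx 0 i) f x)
  end.

Definition smooth_on U f := forall k, class_C k U f.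

Lemma class_C_continuous k U f : class_C k U f ->
  forall x, U x -> {for x, continuous f}.
Proof. by case: k => [|k] []. Qed.

Lemma class_C_pred k U f : class_C k.+1 U f -> class_C k U f.
Proof.
elim: k f => [|k IH] f [cf df]; first by split.
by split=> // i; have [dfi cfi] := df i; split=> //; apply: IH.
Qed.

Lemma class_C_eq k U f g : open U -> (forall x, U x -> f x = g x) ->
  class_C k U f -> class_C k U g.
Proof.
move=> oU; elim: k f g => [|k IH] f g fg Cf.
all: have fgx x : U x -> {near x, f =1 g} by
  move=> Ux; near=> y; apply: fg; near: y; exact: open_nbhs_nbhs.
all: have cg : forall x, U x -> {for x, continuous g} by
  move=> x Ux; rewrite /prop_for /continuous_at -(fg x)//;
  apply: cvg_trans (class_C_continuous Cf Ux); exact: near_eq_cvg (fgx _ Ux).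
  by split.
split=> // i; have [_ /(_ i)[df cf]] := Cf; split.
  by move=> x Ux; apply: near_eq_derivable (fgx _ Ux) (df _ Ux).
by apply: IH cf => x Ux; apply: near_eq_derive; exact: fgx.
Unshelve. all: by end_near. Qed.

Lemma class_C_cst k U (c : R) : class_C k U (cst c).
Proof.
elim: k c => [|k IH] c; first by split=> // x _; exact: cst_continuous.
split=> [x _|i]; first exact: cst_continuous.
split=> [x _|]; first exact: derivable_cst.
rewrite (_ : (fun x => _) = cst 0); first exact: IH.
by apply/funext => x; rewrite derive_cst.
Qed.

Lemma class_C_add k U f g : open U ->
  class_C k U f -> class_C k U g -> class_C k U (f + g).
Proof.
move=> oU; elim: k f g => [|k IH] f g [cf df] [cg dg].
  by split=> // x Ux; apply: continuousD; [exact: cf|exact: cg].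
split=> [x Ux|i]; first by apply: continuousD; [exact: cf|exact: cg].
have [[dfi Cfi] [dgi Cgi]] := (df i, dg i); split=> [x Ux|].
  by apply: derivableD; [exact: dfi|exact: dgi].
apply: class_C_eq (IH _ _ Cfi Cgi) => // x Ux.
by rewrite deriveD//; [exact: dfi|exact: dgi].
Qed.

Lemma class_C_mul k U f g : open U ->
  class_C k U f -> class_C k U g -> class_C k U (f * g).
Proof.
move=> oU; elim: k f g => [|k IH] f g Cf Cg.
  have [[cf _] [cg _]] := (Cf, Cg).
  by split=> // x Ux; apply: continuousM; [exact: cf|exact: cg].
have [[cf df] [cg dg]] := (Cf, Cg).
split=> [x Ux|i]; first by apply: continuousM; [exact: cf|exact: cg].
have [[dfi Cfi] [dgi Cgi]] := (df i, dg i); split=> [x Ux|].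
  by apply: derivableM; [exact: dfi|exact: dgi].
apply: class_C_eq (class_C_add oU (IH _ _ (class_C_pred Cf) Cgi)
  (IH _ _ (class_C_pred Cg) Cfi)) => // x Ux.
by rewrite deriveM//; [exact: dfi|exact: dgi].
Qed.

End euclidean_smoothness.

Section manifold.
Variables (R : realType) (m : nat).

(* [chart_map] and [chart_inv] are total functions; their values outside
   [chart_dom] and its image are irrelevant. *)
Record chart (M : topologicalType) := Chart {
  chart_dom : set M;
  chart_map :> M -> 'rV[R]_m;
  chart_inv : 'rV[R]_m -> M;
  chart_dom_open : open chart_dom;
  chart_codom_open : open (chart_map @` chart_dom);
  chart_mapK : forall x, chart_dom x -> chart_inv (chart_map x) = x;
  chart_continuous : forall x, chart_dom x -> {for x, continuous chart_map};
  chart_inv_continuous : forall u, (chart_map @` chart_dom) u ->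
    {for u, continuous chart_inv} }.

Definition smooth_transition (M : topologicalType) (a b : chart M) :=
  forall i : 'I_m, smooth_on (a @` (chart_dom a `&` chart_dom b))
    (fun u => b (chart_inv a u) 0 i).

(* Any smooth atlas determines the smooth structure, so maximality of the atlas
   is not required. *)
Record manifold := Manifold {
  manifold_space :> topologicalType;
  atlas : set (chart manifold_space);
  manifold_hausdorff : hausdorff_space manifold_space;
  manifold_second_countable : @second_countable manifold_space;
  atlas_cover : forall x, exists2 a, atlas a & chart_dom a x;
  atlas_compatible : forall a b, atlas a -> atlas b -> smooth_transition a b }.

End manifold.

Section smooth_functions.
Variables (R : realType) (m : nat) (M : manifold R m).

Definition smooth : {pred M -> R} := fun f =>
  `[< forall a, @atlas R m M a ->
      smooth_on (a @` chart_dom a) (f \o chart_inv a) >].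

Lemma smooth_cst (c : R) : cst c \in smooth.
Proof. by apply/asboolP => a _ k; exact: class_C_cst. Qed.

Lemma smooth_subring_closed : subring_closed smooth.
Proof.
have Sadd f g : f \in smooth -> g \in smooth -> f + g \in smooth.
  move=> /asboolP sf /asboolP sg; apply/asboolP => a aa k.
  by apply: class_C_add (sf _ aa k) (sg _ aa k); exact: chart_codom_open.
have Smul f g : f \in smooth -> g \in smooth -> f * g \in smooth.
  move=> /asboolP sf /asboolP sg; apply/asboolP => a aa k.
  by apply: class_C_mul (sf _ aa k) (sg _ aa k); exact: chart_codom_open.
split=> [|f g sf sg|//]; first exact: smooth_cst.
apply: Sadd => //; rewrite (_ : - g = cst (-1) * g); last first.
  by apply/funext => x; rewrite /GRing.mul/= mulN1r.
by apply: Smul => //; exact: smooth_cst.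
Qed.
HB.instance Definition _ :=
  GRing.isSubringClosed.Build (M -> R) smooth smooth_subring_closed.

Record smooth_fun := SmoothFun {
  smooth_fun_val :> M -> R; _ : smooth_fun_val \in smooth }.
HB.instance Definition _ := [isSub for smooth_fun_val].
HB.instance Definition _ := [Choice of smooth_fun by <:].
HB.instance Definition _ := GRing.SubChoice_isSubComPzRing.Build (M -> R) smooth
  smooth_fun smooth_subring_closed.

Definition smooth_const (c : R) : smooth_fun := SmoothFun (smooth_cst c).

Lemma smooth_fun_eq (f g : smooth_fun) : (forall p, f p = g p) -> f = g.
Proof. by move=> fg; apply/val_inj/funext. Qed.

End smooth_functions.
Notation "c %:S" := (smooth_const _ c) (at level 2, format "c %:S").

Section tangent.
Variables (R : realType) (m : nat) (M : manifold R m).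
Local Notation C := (smooth_fun M).

(* Tangent vectors at [p] are the derivations at [p] of the algebra of smooth
   functions on [M]. *)
Definition derivation_at (p : M) : {pred C -> R} := fun v =>
  `[< [/\ forall (c : R) f g, v (c%:S * f + g) = c * v f + v g
        & forall f g, v (f * g) = f p * v g + g p * v f] >].

Lemma derivation_at_submod_closed p : submod_closed (derivation_at p).
Proof.
split=> [|a u v /asboolP[lu du] /asboolP[lv dv]]; apply/asboolP; split=> /=.
- by move=> c f g; rewrite mulr0 addr0.
- by move=> f g; rewrite !mulr0 addr0.
- move=> c f g; change (a * u (c%:S * f + g) + v (c%:S * f + g) =
    c * (a * u f + v f) + (a * u g + v g)).
  by rewrite lu lv; ring.
- move=> f g; change (a * u (f * g) + v (f * g) =
    f p * (a * u g + v g) + g p * (a * u f + v f)).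
  by rewrite du dv; ring.
Qed.
HB.instance Definition _ p :=
  GRing.isSubmodClosed.Build R (C -> R) (derivation_at p)
    (derivation_at_submod_closed p).

Record tangent (p : M) := Tangent {
  tangent_val :> C -> R; _ : tangent_val \in derivation_at p }.
HB.instance Definition _ p := [isSub for @tangent_val p].
HB.instance Definition _ p := [Choice of tangent p by <:].
HB.instance Definition _ p := [SubChoice_isSubLmodule of tangent p by <:].

Record vector_field := VectorField {
  vector_field_val :> forall p : M, tangent p;
  vector_field_smooth :
    forall f : C, (fun p => vector_field_val p f) \in @smooth R m M }.

Definition lie_deriv (X : vector_field) (f : C) : C :=
  SmoothFun (vector_field_smooth X f).

Lemma tangent_eq p (u v : tangent p) : (forall f, u f = v f) -> u = v.
Proof. by move=> uv; apply/val_inj/funext. Qed.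

Lemma vector_field_eq (X Y : vector_field) : (forall p, X p = Y p) -> X = Y.
Proof.
case: X Y => [X sX] [Y sY] /= XY.
have {XY}E : X = Y by exact: functional_extensionality_dep.
by case: _ / E sY => sY; congr VectorField; exact: Prop_irrelevance.
Qed.

Lemma tangentP p (v : tangent p) : tangent_val v \in derivation_at p.
Proof. exact: valP. Qed.

Lemma tangentPD p (v : tangent p) (c : R) f g :
  v (c%:S * f + g) = c * v f + v g.
Proof. by have /asboolP[+ _] := tangentP v; apply. Qed.

Lemma tangentM p (v : tangent p) f g : v (f * g) = f p * v g + g p * v f.
Proof. by have /asboolP[_] := tangentP v; apply. Qed.

Lemma smooth_funP (f : C) : (f : M -> R) \in @smooth R m M.
Proof. exact: valP. Qed.

HB.instance Definition _ := gen_eqMixin vector_field.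
HB.instance Definition _ := gen_choiceMixin vector_field.

Program Definition vf_zero := @VectorField (fun p => 0) _.
Next Obligation. by move=> f; exact: smooth_cst. Qed.
Program Definition vf_opp (X : vector_field) := @VectorField (fun p => - X p) _.
Next Obligation.
by move=> X f; have := vector_field_smooth X f; rewrite -rpredN.
Qed.
Program Definition vf_add (X Y : vector_field) :=
  @VectorField (fun p => X p + Y p) _.
Next Obligation.
by move=> X Y f; apply: (rpredD (vector_field_smooth X f) (vector_field_smooth Y f)).
Qed.
Program Definition vf_scale (h : C) (X : vector_field) :=
  @VectorField (fun p => h p *: X p) _.
Next Obligation.
by move=> h X f; apply: (rpredM (smooth_funP h) (vector_field_smooth X f)).
Qed.

Fact vf_addA : associative vf_add.
Proof. by move=> X Y Z; apply: vector_field_eq => p; exact: addrA. Qed.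
Fact vf_addC : commutative vf_add.
Proof. by move=> X Y; apply: vector_field_eq => p; exact: addrC. Qed.
Fact vf_add0 : left_id vf_zero vf_add.
Proof. by move=> X; apply: vector_field_eq => p; exact: add0r. Qed.
Fact vf_addN : left_inverse vf_zero vf_opp vf_add.
Proof. by move=> X; apply: vector_field_eq => p; exact: addNr. Qed.
HB.instance Definition _ := GRing.isZmodule.Build vector_field
  vf_addA vf_addC vf_add0 vf_addN.

Fact vf_scaleA (a b : C) X : vf_scale a (vf_scale b X) = vf_scale (a * b) X.
Proof. by apply: vector_field_eq => p; exact: scalerA. Qed.
Fact vf_scale1 : left_id 1 vf_scale.
Proof. by move=> X; apply: vector_field_eq => p; exact: scale1r. Qed.
Fact vf_scaleDr : right_distributive vf_scale +%R.
Proof. by move=> a X Y; apply: vector_field_eq => p; exact: scalerDr. Qed.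
Fact vf_scaleDl X : {morph vf_scale^~ X : a b / a + b}.
Proof. by move=> a b; apply: vector_field_eq => p; exact: scalerDl. Qed.
HB.instance Definition _ := GRing.Zmodule_isLmodule.Build C vector_field
  vf_scaleA vf_scale1 vf_scaleDr vf_scaleDl.

Section bracket.
Variables X Y : vector_field.
Implicit Types p : M.

Definition bracket_at p (f : C) : R :=
  X p (lie_deriv Y f) - Y p (lie_deriv X f).

Fact bracket_at_derivation p : bracket_at p \in derivation_at p.
Proof.
apply/asboolP; rewrite /bracket_at; split=> [c f g|f g].
  have E Z : lie_deriv Z (c%:S * f + g) = c%:S * lie_deriv Z f + lie_deriv Z g.
    by apply: smooth_fun_eq => q; exact: tangentPD.
  by rewrite !E !tangentPD; ring.
have E Z : lie_deriv Z (f * g) =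
    (1%:S) * (f * lie_deriv Z g) + g * lie_deriv Z f.
  by apply: smooth_fun_eq => q /=; rewrite [LHS]tangentM -[RHS]/(1 * _ + _) mul1r.
by rewrite !E !tangentPD !tangentM /=; ring.
Qed.

Fact bracket_smooth (f : C) :
  (fun p => Tangent (bracket_at_derivation p) f) \in @smooth R m M.
Proof. apply: (rpredB (vector_field_smooth X _) (vector_field_smooth Y _)). Qed.

Definition lie_bracket : vector_field := VectorField bracket_smooth.

End bracket.

End tangent.
Notation "[ 'lie' X , Y ]" := (lie_bracket X Y)
  (at level 0, format "[ 'lie'  X ,  Y ]").

Section tensors.
Variables (R : realType) (m : nat) (M : manifold R m).
Local Notation C := (smooth_fun M).
Local Notation VF := (vector_field M).

(* Tensor fields are families of multilinear maps on the tangent spaces that send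
   smooth vector fields to smooth functions or vector fields.  They coerce to the
   induced maps on vector fields. *)
Record one_form := OneForm {
  one_form_at : forall p : M, {linear tangent p -> R^o};
  one_form_smooth : forall X : VF,
    (fun p => one_form_at p (X p)) \in @smooth R m M }.

Definition one_form_app (w : one_form) (X : VF) : C :=
  SmoothFun (one_form_smooth w X).

Record tensor11 := Tensor11 {
  tensor11_at : forall p : M, {linear tangent p -> tangent p};
  tensor11_smooth : forall (X : VF) (f : C),
    (fun p => tensor11_at p (X p) f) \in @smooth R m M }.

Definition tensor11_app (A : tensor11) (X : VF) : VF :=
  VectorField (tensor11_smooth A X).

Record tensor02 := Tensor02 {
  tensor02_at : forall p : M, tangent p -> tangent p -> R;
  tensor02_linearl : forall p v, linear (@tensor02_at p ^~ v : tangent p -> R^o);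
  tensor02_linearr : forall p u, linear (@tensor02_at p u : tangent p -> R^o);
  tensor02_smooth : forall X Y : VF,
    (fun p => tensor02_at (X p) (Y p)) \in @smooth R m M }.

Definition tensor02_app (T : tensor02) (X Y : VF) : C :=
  SmoothFun (tensor02_smooth T X Y).

End tensors.
Coercion one_form_app : one_form >-> Funclass.
Coercion tensor11_app : tensor11 >-> Funclass.
Coercion tensor02_app : tensor02 >-> Funclass.

Section riemannian.
Variables (R : realType) (m : nat) (M : manifold R m).
Local Notation C := (smooth_fun M).
Local Notation VF := (vector_field M).
Implicit Types (g : tensor02 M) (nabla : VF -> VF -> VF) (X Y Z : VF).

Definition riemannian_metric g :=
  (forall (p : M) (u v : tangent p), tensor02_at g u v = tensor02_at g v u) /\
  (forall (p : M) (v : tangent p), v != 0 -> 0 < tensor02_at g v v).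

Definition affine_connection nabla :=
  [/\ forall (f : C) X Y Z, nabla (f *: X + Y) Z = f *: nabla X Z + nabla Y Z,
      forall X Y Z, nabla X (Y + Z) = nabla X Y + nabla X Z
    & forall (f : C) X Y,
        nabla X (f *: Y) = lie_deriv X f *: Y + f *: nabla X Y].

Definition levi_civita g nabla :=
  [/\ affine_connection nabla,
      forall X Y, nabla X Y - nabla Y X = [lie X, Y]
    & forall X Y Z,
        lie_deriv X (g Y Z) = g (nabla X Y) Z + g Y (nabla X Z)].

Definition curvature nabla X Y Z : VF :=
  nabla X (nabla Y Z) - nabla Y (nabla X Z) - nabla [lie X, Y] Z.

Definition frame_at (p : M) (E : 'I_m -> VF) :=
  forall v : tangent p,
    exists! c : 'rV[R]_m, v = \sum_(i < m) c 0 i *: E i p.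

(* [A] stands for a C^oo(M)-linear endomorphism of the module of vector fields,
   i.e. a (1,1)-tensor field; the trace of the induced endomorphism of the
   tangent space at [p] does not depend on the basis used to compute it, and
   every basis of the tangent space extends to global vector fields. *)
Definition is_trace (A : VF -> VF) (t : C) :=
  forall p : M, exists (E : 'I_m -> VF) (a : 'M[R]_m),
    [/\ frame_at p E,
        forall j, A (E j) p = \sum_(i < m) a i j *: E i p
      & t p = \tr a].

Definition ricci_tensor nabla (S : tensor02 M) :=
  forall Y Z, is_trace (fun X => curvature nabla X Y Z) (S Y Z).

Definition einstein g (S : tensor02 M) :=
  exists c : R, forall X Y, S X Y = c%:S * g X Y.

Definition lie_derivative_metric V g X Y : C :=
  lie_deriv V (g X Y) - g [lie V, X] Y - g X [lie V, Y].

End riemannian.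

Section contact.
Variables (R : realType) (m : nat) (M : manifold R m).
Local Notation C := (smooth_fun M).
Local Notation VF := (vector_field M).
Variables (phi : tensor11 M) (xi : VF) (eta : one_form M) (g : tensor02 M).

Definition almost_contact_metric_structure :=
  riemannian_metric g /\
  [/\ forall X, phi (phi X) = - X + eta X *: xi, eta xi = 1,
      forall X, eta (phi X) = 0 & phi xi = 0] /\
  [/\ forall X Y, g (phi X) (phi Y) = g X Y - eta X * eta Y,
      forall X Y, g X (phi Y) = - g (phi X) Y
    & forall X, g X xi = eta X].

(* The convention for [d eta] carries the factor 1/2. *)
Definition exterior_derivative X Y : C :=
  (2^-1)%:S * (lie_deriv X (eta Y) - lie_deriv Y (eta X) - eta [lie X, Y]).

Definition nijenhuis X Y : VF :=
  phi (phi [lie X, Y]) + [lie phi X, phi Y]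
  - phi [lie phi X, Y] - phi [lie X, phi Y].

Definition contact_metric_structure :=
  almost_contact_metric_structure /\
  (forall X Y, exterior_derivative X Y = g X (phi Y)).

Definition normal_structure :=
  forall X Y, (2 * exterior_derivative X Y) *: xi + nijenhuis X Y = 0.

Definition sasakian := contact_metric_structure /\ normal_structure.

Definition star_ricci_tensor (nabla : VF -> VF -> VF) (Sstar : tensor02 M) :=
  forall X Y, exists2 t : C,
    is_trace (fun Z => phi (curvature nabla X (phi Y) Z)) t &
    Sstar X Y = (2^-1)%:S * t.

End contact.

Section soliton.
Variables (R : realType) (n : nat) (M : manifold R (2 * n).+1).
Local Notation C := (smooth_fun M).

Definition star_conformal_eta_ricci_soliton (xi : vector_field M)
    (eta : one_form M) (g Sstar : tensor02 M) (lambda mu : R) (p : C) :=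
  forall X Y : vector_field M,
    lie_derivative_metric xi g X Y + 2 * Sstar X Y
    + ((2 * lambda)%:S - (p + (2 / (2 * n).+1%:R)%:S)) * g X Y
    + (2 * mu)%:S * (eta X * eta Y) = 0.

End soliton.

(* Main.v *)
(** Normality and the closedness of the fundamental form make [xi] a Killing
    field, whence [nabla_X xi = - phi X] and
    [(nabla_X phi) Y = g(X,Y) xi - eta(Y) X]; therefore
    [R(X,Y) xi = eta(Y) X - eta(X) Y], whose trace gives
    [S(Y,xi) = 2n eta(Y)].  Taking [Z = xi] in
    [S(R(xi,Y)X,Z) + S(X,R(xi,Y)Z) = 0] and using that [R(xi,Y)] is
    skew-symmetric for [g], all the terms in [eta] cancel and
    [S = 2n g] remains, so the Einstein constant is [2n]. *)
Require Import Defs.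
From HB Require Import structures.
From mathcomp Require Import all_boot all_order all_algebra.
From mathcomp Require Import all_classical all_reals.
From mathcomp Require Import topology normedtype derive.
From mathcomp Require Import ring lra.
Set Implicit Arguments.
Unset Strict Implicit.
Unset Printing Implicit Defensive.
Import GRing.Theory Num.Theory numFieldNormedType.Exports.
Local Open Scope classical_set_scope.
Local Open Scope ring_scope.

(** * Calculus of derivations, brackets and tensor fields *)

Section tensor_calculus.
Variables (R : realType) (m : nat) (M : manifold R m).
Implicit Types (X Y Z : vector_field M) (f h : smooth_fun M) (p : M).

Lemma smooth_funD f h p : (f + h) p = f p + h p. Proof. by []. Qed.
Lemma smooth_funN f p : (- f) p = - f p. Proof. by []. Qed.
Lemma smooth_funB f h p : (f - h) p = f p - h p. Proof. by []. Qed.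
Lemma smooth_funM f h p : (f * h) p = f p * h p. Proof. by []. Qed.
Lemma smooth_fun0 p : (0 : smooth_fun M) p = 0. Proof. by []. Qed.
Lemma smooth_fun1 p : (1 : smooth_fun M) p = 1. Proof. by []. Qed.
Lemma smooth_constE (c : R) p : (c%:S : smooth_fun M) p = c. Proof. by []. Qed.
Lemma smooth_fun2 p : (2 : smooth_fun M) p = 2. Proof. by []. Qed.
Definition smooth_funE := (smooth_funB, smooth_funD, smooth_funN, smooth_funM,
  smooth_fun2, smooth_fun0, smooth_fun1, smooth_constE).

(** Evaluation at a point moves identities of smooth functions into the ordered field [R], where
    [lra] applies. *)
Lemma smooth_fun_at p f h : f = h -> f p = h p. Proof. by move=> ->. Qed.

Lemma lie_derivD X f h : lie_deriv X (f + h) = lie_deriv X f + lie_deriv X h.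
Proof.
apply: smooth_fun_eq => p; have := tangentPD (X p) 1 f h.
have -> : 1%:S * f = f by apply: smooth_fun_eq => q; rewrite smooth_funM mul1r.
by rewrite mul1r.
Qed.

Lemma lie_deriv0 X : lie_deriv X 0 = 0.
Proof. by apply: (addrI (lie_deriv X 0)); rewrite -lie_derivD !addr0. Qed.

Lemma lie_derivN X f : lie_deriv X (- f) = - lie_deriv X f.
Proof. by apply: (addrI (lie_deriv X f)); rewrite -lie_derivD !subrr lie_deriv0. Qed.

Lemma lie_derivB X f h : lie_deriv X (f - h) = lie_deriv X f - lie_deriv X h.
Proof. by rewrite lie_derivD lie_derivN. Qed.

Lemma lie_derivM X f h :
  lie_deriv X (f * h) = f * lie_deriv X h + h * lie_deriv X f.
Proof. by apply: smooth_fun_eq => p; exact: tangentM. Qed.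

Lemma lie_deriv1 X : lie_deriv X 1 = 0.
Proof.
apply: (addrI (lie_deriv X 1)); rewrite -[in RHS](mulr1 1) lie_derivM.
by rewrite !mul1r addr0.
Qed.

Lemma lie_derivZ X (c : R) f : lie_deriv X (c%:S * f) = c%:S * lie_deriv X f.
Proof.
rewrite -[in LHS](addr0 (c%:S * f)); apply: smooth_fun_eq => p.
rewrite [LHS](tangentPD (X p) c f 0).
by rewrite -[X p 0]/(lie_deriv X 0 p) lie_deriv0 addr0.
Qed.

Lemma lie_deriv_bracket X Y f :
  lie_deriv [lie X, Y] f = lie_deriv X (lie_deriv Y f) - lie_deriv Y (lie_deriv X f).
Proof. by apply: smooth_fun_eq. Qed.

Lemma eq_lie_deriv X Y : (forall f, lie_deriv X f = lie_deriv Y f) -> X = Y.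
Proof.
move=> XY; apply: vector_field_eq => p; apply: tangent_eq => f.
by have /(congr1 (fun h : smooth_fun M => h p)) := XY f.
Qed.

Lemma lie_deriv_addl X Y f : lie_deriv (X + Y) f = lie_deriv X f + lie_deriv Y f.
Proof. by apply: smooth_fun_eq. Qed.

Lemma lie_bracketC X Y : [lie X, Y] = - [lie Y, X].
Proof.
apply: eq_lie_deriv => f; apply: smooth_fun_eq => p.
by change (X p (lie_deriv Y f) - Y p (lie_deriv X f) =
  - (Y p (lie_deriv X f) - X p (lie_deriv Y f))); rewrite opprB.
Qed.

(** Fields are compared as operators on functions, where the bracket is a commutator. *)
Lemma lie_bracket_jacobi X Y Z :
  [lie [lie X, Y], Z] + [lie [lie Y, Z], X] + [lie [lie Z, X], Y] = 0.
Proof.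
apply: eq_lie_deriv => f.
rewrite !lie_deriv_addl !lie_deriv_bracket !lie_derivB.
apply: smooth_fun_eq => p.
have -> : lie_deriv 0 f = 0 by exact: smooth_fun_eq.
by rewrite !smooth_funE; ring.
Qed.

Lemma lie_bracket0 X : [lie 0, X] = 0.
Proof.
apply: eq_lie_deriv => f; rewrite lie_deriv_bracket.
have E h : lie_deriv (0 : vector_field M) h = 0 by exact: smooth_fun_eq.
by rewrite !E lie_deriv0 subrr.
Qed.

Section one_form.
Variable w : one_form M.

Lemma one_formD X Y : w (X + Y) = w X + w Y.
Proof. by apply: smooth_fun_eq => p; apply: (linearD (one_form_at w p)). Qed.
Lemma one_form0 : w 0 = 0.
Proof. by apply: smooth_fun_eq => p; apply: (linear0 (one_form_at w p)). Qed.
End one_form.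

Section tensor11.
Variable A : tensor11 M.

Lemma tensor11D X Y : A (X + Y) = A X + A Y.
Proof. by apply: vector_field_eq => p; apply: (linearD (tensor11_at A p)). Qed.
Lemma tensor11_0 : A 0 = 0.
Proof. by apply: vector_field_eq => p; apply: (linear0 (tensor11_at A p)). Qed.
Lemma tensor11N X : A (- X) = - A X.
Proof. by apply: vector_field_eq => p; apply: (linearN (tensor11_at A p)). Qed.
Lemma tensor11Z f X : A (f *: X) = f *: A X.
Proof. by apply: vector_field_eq => p; apply: (linearZ_LR (tensor11_at A p)). Qed.
End tensor11.

Section tensor02.
Variable T : tensor02 M.

Lemma tensor02Dl X Y Z : T (X + Y) Z = T X Z + T Y Z.
Proof.
apply: smooth_fun_eq => p; have := tensor02_linearl T (Z p) 1 (X p) (Y p).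
by rewrite !scale1r.
Qed.
Lemma tensor02Dr X Y Z : T X (Y + Z) = T X Y + T X Z.
Proof.
apply: smooth_fun_eq => p; have := tensor02_linearr T (X p) 1 (Y p) (Z p).
by rewrite !scale1r.
Qed.
Lemma tensor02_0l Z : T 0 Z = 0.
Proof. by apply: (addrI (T 0 Z)); rewrite -tensor02Dl !addr0. Qed.
Lemma tensor02_0r Z : T Z 0 = 0.
Proof. by apply: (addrI (T Z 0)); rewrite -tensor02Dr !addr0. Qed.
Lemma tensor02Nl X Z : T (- X) Z = - T X Z.
Proof. by apply: (addrI (T X Z)); rewrite -tensor02Dl !subrr tensor02_0l. Qed.
Lemma tensor02Nr X Z : T X (- Z) = - T X Z.
Proof. by apply: (addrI (T X Z)); rewrite -tensor02Dr !subrr tensor02_0r. Qed.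
Lemma tensor02Zl f X Z : T (f *: X) Z = f * T X Z.
Proof.
(* The zero summand gives the argument the shape a *: u + v of the pointwise linearity axiom. *)
rewrite -[f *: X]addr0; apply: smooth_fun_eq => p.
have := tensor02_linearl T (Z p) (f p) (X p) 0.
rewrite -[0 in X in X -> _]/((0 : vector_field M) p) => E.
etransitivity; first exact: E.
by rewrite -[X in _ + X]/(T 0 Z p) tensor02_0l addr0.
Qed.
Lemma tensor02Zr f X Z : T X (f *: Z) = f * T X Z.
Proof.
rewrite -[f *: Z]addr0; apply: smooth_fun_eq => p.
have := tensor02_linearr T (X p) (f p) (Z p) 0.
rewrite -[0 in X in X -> _]/((0 : vector_field M) p) => E.
etransitivity; first exact: E.
by rewrite -[X in _ + X]/(T X 0 p) tensor02_0r addr0.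
Qed.
End tensor02.

Lemma riemannian_sym (g : tensor02 M) X Y : riemannian_metric g -> g X Y = g Y X.
Proof. by move=> [gC _]; apply: smooth_fun_eq => p; exact: gC. Qed.

(** Testing on Z = X - Y suffices, by positivity. This reduces vector identities to scalar ones. *)
Lemma riemannian_nondegenerate (g : tensor02 M) X Y : riemannian_metric g ->
  (forall Z, g X Z = g Y Z) -> X = Y.
Proof.
move=> [_ gpos] XY; apply/eqP; rewrite -subr_eq0; apply/eqP.
have E : g (X - Y) (X - Y) = 0 by rewrite tensor02Dl tensor02Nl XY subrr.
apply: vector_field_eq => p; apply/eqP; case: (boolP (_ == _)) => // /gpos.
by rewrite -[tensor02_at _ _ _]/(g (X - Y) (X - Y) p) E Order.POrderTheory.ltxx.
Qed.

End tensor_calculus.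

(** * Exact 2-forms are closed *)

Section exterior_derivative.
Variables (R : realType) (m : nat) (M : manifold R m) (w : one_form M).
Local Notation d := (exterior_derivative w).

(** Second derivatives cancel because a bracket acts as a commutator; double brackets cancel by [w]
    applied to the Jacobi identity. *)
Lemma exterior_derivative_closed X Y Z :
  lie_deriv X (d Y Z) + lie_deriv Y (d Z X) + lie_deriv Z (d X Y)
  - d [lie X, Y] Z - d [lie Y, Z] X - d [lie Z, X] Y = 0.
Proof.
have J := congr1 w (lie_bracket_jacobi X Y Z).
apply: smooth_fun_eq => p; move/(smooth_fun_at p): J.
rewrite /exterior_derivative !one_formD one_form0 !lie_derivZ !lie_derivB.
by rewrite !lie_deriv_bracket !smooth_funE; lra.
Qed.

End exterior_derivative.

(** * Structure equations of the Sasakian manifold and its Levi-Civita connection *)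

Section sasakian.
Variables (R : realType) (m : nat) (M : manifold R m).
Local Notation C := (smooth_fun M).
Variables (phi : tensor11 M) (xi : vector_field M) (eta : one_form M).
Variables (g : tensor02 M).
Variables (nabla : vector_field M -> vector_field M -> vector_field M).
Hypotheses (hsas : sasakian phi xi eta g) (hnabla : levi_civita g nabla).
Implicit Types X Y Z : vector_field M.

Let gE := (@tensor02Dl _ _ _ g, @tensor02Dr _ _ _ g, @tensor02Nl _ _ _ g,
  @tensor02Nr _ _ _ g, @tensor02Zl _ _ _ g, @tensor02Zr _ _ _ g).

Let hg : riemannian_metric g.
Proof. by case: hsas => [[[]]]. Qed.

Let gC X Y : g X Y = g Y X.
Proof. exact: (riemannian_sym _ _ hg). Qed.

Let phi2 X : phi (phi X) = - X + eta X *: xi.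
Proof. by case: hsas => [[[_ [[H _ _ _] _]] _] _]. Qed.

Let eta_xi : eta xi = 1.
Proof. by case: hsas => [[[_ [[_ H _ _] _]] _] _]. Qed.

Let eta_phi X : eta (phi X) = 0.
Proof. by case: hsas => [[[_ [[_ _ H _] _]] _] _]. Qed.

Let phi_xi : phi xi = 0.
Proof. by case: hsas => [[[_ [[_ _ _ H] _]] _] _]. Qed.

Let g_phir X Y : g X (phi Y) = - g (phi X) Y.
Proof. by case: hsas => [[[_ [_ [_ H _]]] _] _]. Qed.

Let g_phil X Y : g (phi X) Y = - g X (phi Y).
Proof. by rewrite g_phir opprK. Qed.

Let g_xi X : g X xi = eta X.
Proof. by case: hsas => [[[_ [_ [_ _ H]]] _] _]. Qed.

Let g_xil X : g xi X = eta X.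
Proof. by rewrite gC. Qed.

Let d_eta X Y : exterior_derivative eta X Y = g X (phi Y).
Proof. by case: hsas => [[_ H] _]. Qed.

Let normal X Y :
  (2 * g X (phi Y)) *: xi + nijenhuis phi X Y = 0.
Proof. by case: hsas => [_ H]; rewrite -d_eta. Qed.

Let nablaDl f X Y Z : nabla (f *: X + Y) Z = f *: nabla X Z + nabla Y Z.
Proof. by case: hnabla => [[H _ _] _ _]. Qed.

Let nablaDr X Y Z : nabla X (Y + Z) = nabla X Y + nabla X Z.
Proof. by case: hnabla => [[_ H _] _ _]. Qed.

Let nabla0r X : nabla X 0 = 0.
Proof. by apply: (addrI (nabla X 0)); rewrite -nablaDr !addr0. Qed.

Let nablaNr X Y : nabla X (- Y) = - nabla X Y.
Proof. by apply: (addrI (nabla X Y)); rewrite -nablaDr !subrr nabla0r. Qed.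

Let torsion_free X Y : [lie X, Y] = nabla X Y - nabla Y X.
Proof. by case: hnabla => [_ H _]. Qed.

Let metric_compat X Y Z :
  lie_deriv X (g Y Z) = g (nabla X Y) Z + g Y (nabla X Z).
Proof. by case: hnabla => [_ _ H]. Qed.

(** * Invariance of [eta], [phi] and [g] along the Reeb field [xi] *)

Let d_etaE X Y :
  lie_deriv X (eta Y) - lie_deriv Y (eta X) - eta [lie X, Y] = 2 * g X (phi Y).
Proof.
apply: smooth_fun_eq => p; have /(smooth_fun_at p) := d_eta X Y.
by rewrite /exterior_derivative !smooth_funE; lra.
Qed.

(** This is d eta(xi, X) = g(xi, phi X) = eta(phi X) = 0. *)
Lemma eta_reeb_bracket X : eta [lie xi, X] = lie_deriv xi (eta X).
Proof.
apply: smooth_fun_eq => p; have /(smooth_fun_at p) := d_etaE xi X.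
by rewrite g_xil eta_phi eta_xi lie_deriv1 !smooth_funE; lra.
Qed.

(** Normality at (xi, X), where phi xi = 0, gives the identity up to an application of [phi]. *)
Lemma reeb_bracket_phi X : [lie xi, phi X] = phi [lie xi, X].
Proof.
have E : phi [lie xi, phi X] = phi (phi [lie xi, X]).
  apply: (riemannian_nondegenerate hg) => Z; apply: smooth_fun_eq => p.
  have /(congr1 (fun V => g V Z p)) := normal xi X.
  rewrite /nijenhuis phi_xi !lie_bracket0 !gE tensor11_0 tensor02_0l g_xil eta_phi.
  by rewrite !smooth_funE; lra.
(* A second [phi] undoes the first: both fields lie in the kernel of [eta], on which phi^2 = -1. *)
have /(congr1 phi) := E; rewrite !phi2 eta_phi eta_reeb_bracket eta_phi.
by rewrite lie_deriv0 scale0r !addr0 => /oppr_inj.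
Qed.

(** The fundamental form g(X, phi Y) is the exact form d eta. *)
Lemma fundamental_form_closed X Y Z :
  lie_deriv X (g Y (phi Z)) + lie_deriv Y (g Z (phi X)) + lie_deriv Z (g X (phi Y))
  - g [lie X, Y] (phi Z) - g [lie Y, Z] (phi X) - g [lie Z, X] (phi Y) = 0.
Proof. by rewrite -!d_eta exterior_derivative_closed. Qed.

(** Closedness at (xi, X, phi Y) says that [xi] preserves g(X, phi^2 Y) = -g(X,Y) + eta(X) eta(Y);
    the [eta] part is already invariant. *)
Lemma reeb_killing X Y :
  lie_deriv xi (g X Y) = g [lie xi, X] Y + g X [lie xi, Y].
Proof.
apply: smooth_fun_eq => p.
have /(smooth_fun_at p) := fundamental_form_closed xi X (phi Y).
rewrite phi_xi !tensor02_0r g_xil eta_phi !lie_deriv0 [[lie phi Y, _]]lie_bracketC.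
rewrite reeb_bracket_phi !gE -[g (phi _) _]opprK -g_phir !phi2 !gE !g_xi.
rewrite !eta_reeb_bracket lie_derivD lie_derivN lie_derivM.
by rewrite [g X [lie _, _]]gC !smooth_funE; lra.
Qed.

(** The Killing equation kills the symmetric part of g(nabla_X xi, Y); d eta determines the skew
    part. *)
Lemma nabla_reeb X : nabla X xi = - phi X.
Proof.
apply: (riemannian_nondegenerate hg) => Y; apply: smooth_fun_eq => p.
have /(smooth_fun_at p) := reeb_killing X Y.
have /(smooth_fun_at p) := d_etaE X Y.
rewrite -!g_xi !metric_compat !torsion_free !gE g_phir [g Y (nabla X xi)]gC.
by rewrite !smooth_funE; lra.
Qed.

(** * The covariant derivative of [phi]: [dphi X Y] is (nabla_X phi) Y *)

Let dphi X Y : vector_field M := nabla X (phi Y) - phi (nabla X Y).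

(** Derivative of the skewness of [phi], as [g] is parallel. *)
Let dphi_skew X Y Z : g (dphi X Y) Z = - g (dphi X Z) Y.
Proof.
apply: smooth_fun_eq => p.
have : lie_deriv X (g Y (phi Z)) + lie_deriv X (g (phi Y) Z) = 0.
  by rewrite -lie_derivD g_phir addNr lie_deriv0.
move/(smooth_fun_at p); rewrite !metric_compat /dphi !gE !g_phir.
rewrite [g (nabla X (phi Z)) Y]gC [g (phi (nabla X Z)) Y]gC g_phir.
by rewrite !smooth_funE; lra.
Qed.

(** Closedness of the fundamental form, with brackets expressed through the torsion-free [nabla]. *)
Let dphi_cyclic X Y Z : g (dphi X Y) Z + g (dphi Y Z) X + g (dphi Z X) Y = 0.
Proof.
apply: smooth_fun_eq => p.
have /(smooth_fun_at p) := fundamental_form_closed X Y Z.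
have /(smooth_fun_at p) := dphi_skew X Y Z.
have /(smooth_fun_at p) := dphi_skew Y Z X.
have /(smooth_fun_at p) := dphi_skew Z X Y.
rewrite !metric_compat !torsion_free /dphi !gE.
rewrite [g Y (nabla X _)]gC [g Z (nabla Y _)]gC [g X (nabla Z _)]gC.
by rewrite !g_phil !smooth_funE; lra.
Qed.

(** Normality paired with [Z], the brackets in the Nijenhuis tensor being expressed through
    [nabla]. *)
Let dphi_normal X Y Z :
  g (dphi (phi X) Y) Z - g (dphi (phi Y) X) Z - g (dphi Y X) (phi Z)
  + g (dphi X Y) (phi Z) = - (2 * g X (phi Y) * eta Z).
Proof.
apply: smooth_fun_eq => p.
have /(congr1 (fun V => g V Z p)) := normal X Y.
rewrite /nijenhuis /dphi !torsion_free !tensor11D !tensor11N !gE tensor02_0l g_xil.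
by rewrite !g_phil !smooth_funE; lra.
Qed.

Let dphi_reeb X : dphi X xi = - X + eta X *: xi.
Proof.
rewrite /dphi phi_xi nabla0r nabla_reeb.
by rewrite tensor11N opprK add0r phi2.
Qed.

(* The defect in the formula for [nabla phi]; it satisfies the homogeneous
   versions of the identities for [dphi]. *)
Let ddphi X Y Z : C := g (dphi X Y) Z - g X Y * eta Z + eta Y * g X Z.

Let ddphi_linear f X X' Y Z :
  ddphi (f *: X + X') Y Z = f * ddphi X Y Z + ddphi X' Y Z.
Proof.
apply: smooth_fun_eq => p; rewrite /ddphi /dphi !nablaDl tensor11D tensor11Z !gE.
by rewrite !smooth_funE; ring.
Qed.

Let ddphi_skew X Y Z : ddphi X Y Z = - ddphi X Z Y.
Proof.
by apply: smooth_fun_eq => p; rewrite /ddphi dphi_skew !smooth_funE; ring.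
Qed.

Let ddphi_cyclic X Y Z : ddphi X Y Z + ddphi Y Z X + ddphi Z X Y = 0.
Proof.
apply: smooth_fun_eq => p; have /(smooth_fun_at p) := dphi_cyclic X Y Z.
by rewrite /ddphi [g Z X]gC [g Z Y]gC [g Y X]gC !smooth_funE; lra.
Qed.

Let ddphi_normal X Y Z :
  ddphi (phi X) Y Z - ddphi (phi Y) X Z - ddphi Y X (phi Z)
  + ddphi X Y (phi Z) = 0.
Proof.
apply: smooth_fun_eq => p; have /(smooth_fun_at p) := dphi_normal X Y Z.
have /(smooth_fun_at p) := g_phir Y X; rewrite [g Y _]gC.
rewrite /ddphi !eta_phi [g Y X]gC [g (phi Y) X]gC !g_phir !smooth_funE.
by move=> ->; lra.
Qed.

(** [dphi_reeb] and skewness make [ddphi] vanish when [xi] is in either of the last two slots;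
    cyclicity carries this to the first. *)
Let ddphi_reeb X Y : ddphi xi X Y = 0.
Proof.
have H Z W : ddphi Z W xi = 0.
  apply: smooth_fun_eq => p; rewrite ddphi_skew /ddphi dphi_reeb eta_xi !gE g_xi.
  by rewrite g_xil !smooth_funE; ring.
have := ddphi_cyclic xi X Y.
by rewrite H addr0 [ddphi Y _ _]ddphi_skew H oppr0 addr0.
Qed.

Let ddphi_phi X Y Z : ddphi (phi X) Y Z = 0.
Proof.
(* By skewness and cyclicity, [ddphi_normal] says that [q X Y Z := ddphi (phi X) Y Z]
   satisfies [q X Y Z + q Y Z X = q Z X Y]; adding this to its cyclic
   permutation gives [2 q = 0]. *)
apply: smooth_fun_eq => p.
have N W1 W2 W3 : ddphi (phi W1) W2 W3 p + ddphi (phi W2) W3 W1 p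
    = ddphi (phi W3) W1 W2 p.
  have /(smooth_fun_at p) := ddphi_normal W1 W2 W3.
  have /(smooth_fun_at p) := ddphi_cyclic W1 W2 (phi W3).
  have /(smooth_fun_at p) := ddphi_skew (phi W2) W1 W3.
  have /(smooth_fun_at p) := ddphi_skew W2 W1 (phi W3).
  by rewrite !smooth_funE; lra.
by have := N X Y Z; have := N Z X Y; rewrite smooth_funE; lra.
Qed.

(** Splitting X = eta(X) xi - phi(phi X) reduces the first slot to [ddphi_reeb] and [ddphi_phi]. *)
Let ddphi_eq0 X Y Z : ddphi X Y Z = 0.
Proof.
have E : eta X *: xi + - X = phi (phi X) by rewrite phi2 addrC.
have := ddphi_linear (-1) X (eta X *: xi) Y Z.
rewrite scaleN1r addrC E ddphi_phi -[eta X *: xi]addr0 ddphi_linear ddphi_reeb.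
have -> : ddphi 0 Y Z = 0.
  by apply: (addrI (1 * ddphi 0 Y Z)); rewrite -ddphi_linear scaler0 !addr0 mul1r.
by rewrite mulr0 !addr0 mulN1r => /esym/eqP; rewrite oppr_eq0 => /eqP.
Qed.

Lemma nabla_phi X Y : nabla X (phi Y) - phi (nabla X Y) = g X Y *: xi - eta Y *: X.
Proof.
apply: (riemannian_nondegenerate hg) => Z; apply: smooth_fun_eq => p.
have /(smooth_fun_at p) := ddphi_eq0 X Y Z; rewrite /ddphi /dphi !gE g_xil.
by rewrite !smooth_funE; lra.
Qed.

(** * Curvature identities *)

Lemma curvature_reeb X Y : curvature nabla X Y xi = eta Y *: X - eta X *: Y.
Proof.
apply: (riemannian_nondegenerate hg) => Z; apply: smooth_fun_eq => p.
have /(congr1 (fun V => g V Z p)) := nabla_phi X Y.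
have /(congr1 (fun V => g V Z p)) := nabla_phi Y X.
(* Here R(X,Y) xi = (nabla_Y phi) X - (nabla_X phi) Y, and the [xi] terms cancel by symmetry of
   [g]. *)
rewrite /curvature !nabla_reeb !nablaNr torsion_free tensor11D tensor11N !gE.
by rewrite [g Y X]gC !smooth_funE; lra.
Qed.

(** Metric compatibility, used twice, expands the commutator of X and Y acting on g(Z,W); the mixed
    terms cancel. *)
Lemma metric_curvature_skew X Y Z W :
  g (curvature nabla X Y Z) W = - g Z (curvature nabla X Y W).
Proof.
apply: smooth_fun_eq => p.
have /(smooth_fun_at p) := lie_deriv_bracket X Y (g Z W).
rewrite !metric_compat !lie_derivD !metric_compat /curvature !gE !smooth_funE.
by lra.
Qed.

End sasakian.

(** * Traces in a frame *)

Section trace.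
Variables (R : realType) (m : nat) (M : manifold R m).

Lemma frame_coord_inj (p : M) (E : 'I_m -> vector_field M) (b c : 'rV[R]_m) :
  frame_at p E -> \sum_(i < m) b 0 i *: E i p = \sum_(i < m) c 0 i *: E i p -> b = c.
Proof.
move=> /(_ (\sum_(i < m) b 0 i *: E i p))[a [_ au]] bc.
by rewrite -(au b)// -(au c).
Qed.

Lemma trace_scalar_sub_rank1 (f : smooth_fun M) (w : one_form M)
    (V : vector_field M) (t : smooth_fun M) :
  is_trace (fun X => f *: X - w X *: V) t -> t = m%:R%:S * f - w V.
Proof.
move=> tr; apply: smooth_fun_eq => p.
have [E [a [fE aE tE]]] := tr p; have [c [cE _]] := fE (V p).
(* Sum of the diagonal entries in the frame supplied by [is_trace], with [c] the coordinates of [V]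
   in it. *)
have -> : t p = \sum_(j < m) (f p - w (E j) p * c 0 j).
  rewrite tE; apply: eq_bigr => j _.
  pose b : 'rV[R]_m := \row_i a i j.
  pose b' : 'rV[R]_m := \row_i (f p * (i == j)%:R - w (E j) p * c 0 i).
  suff /rowP/(_ j) : b = b' by rewrite !mxE eqxx mulr1.
  apply: (frame_coord_inj fE).
  transitivity ((f *: E j - w (E j) *: V) p).
    by rewrite aE; apply: eq_bigr => i _; rewrite mxE.
  rewrite -[LHS]/(f p *: E j p - w (E j) p *: V p) cE.
  under [RHS]eq_bigr => i _ do rewrite mxE scalerBl -scalerA.
  rewrite sumrB -scaler_sumr; congr (_ *: _ - _); last first.
    by rewrite scaler_sumr; apply: eq_bigr => i _; rewrite scalerA.
  rewrite (bigD1 j)//= eqxx scale1r big1 ?addr0// => i /negbTE ->.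
  by rewrite scale0r.
rewrite sumrB sumr_const card_ord !smooth_funE mulr_natl; congr (_ - _).
rewrite -[w V p]/(one_form_at w p (V p)) cE linear_sum.
by apply: eq_bigr => i _; rewrite linearZ_LR mulrC.
Qed.

End trace.

(** * The Ricci tensor under R(xi,X).S = 0 *)

Theorem corollary4p2 (R : realType) (n : nat) (hn : (1 <= n)%N)
    (M : manifold R (2 * n).+1) (hconn : connected [set: M])
    (phi : tensor11 M) (xi : vector_field M) (eta : one_form M)
    (g : tensor02 M) (hsas : sasakian phi xi eta g)
    (nabla : vector_field M -> vector_field M -> vector_field M)
    (hnabla : levi_civita g nabla)
    (S : tensor02 M) (hS : ricci_tensor nabla S)
    (Sstar : tensor02 M) (hSstar : star_ricci_tensor phi nabla Sstar)
    (hRS : forall X Y Z : vector_field M,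
      S (curvature nabla xi X Y) Z + S Y (curvature nabla xi X Z) = 0)
    (hsol : exists (lambda mu : R) (p : smooth_fun M),
      star_conformal_eta_ricci_soliton xi eta g Sstar lambda mu p) :
  einstein g S.
Proof.
have [[[gR [[_ eta_xi _ _] [_ _ g_xi]]] _] _] := hsas.
(* The trace of X |-> R(X,Y) xi is (2n+1) eta(Y) - eta(Y). *)
have S_reeb Y : S Y xi = (2 * n)%:R%:S * eta Y.
  have tr : is_trace (fun X => eta Y *: X - eta X *: Y) (S Y xi).
    move=> p; have [E [a [fE aE tE]]] := hS Y xi p.
    exists E, a; split=> // j; rewrite -aE.
    by rewrite (curvature_reeb hsas hnabla).
  apply: smooth_fun_eq => p.
  by rewrite (trace_scalar_sub_rank1 tr) !smooth_funE -natr1; ring.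
exists (2 * n)%:R => X Y; apply: smooth_fun_eq => p.
have /(smooth_fun_at p) := metric_curvature_skew hnabla xi Y X xi.
have /(smooth_fun_at p) := hRS Y X xi.
rewrite S_reeb (curvature_reeb hsas hnabla) g_xi eta_xi scale1r.
rewrite !tensor02Dr !tensor02Nr !tensor02Zr S_reeb g_xi => hSXY hR.
(* [hR] reads eta(R(xi,Y)X) = g(X,Y) - eta(X) eta(Y); substituted in [hSXY], it cancels the [eta]
   products. *)
by move: hSXY; rewrite !smooth_funE hR !smooth_funE; lra.
Qed.
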